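(* Let $\psi:\mathbb{R}^n\to\mathbb{R}$ be a proper, lower semicontinuous, continuously differentiable convex function with $L_\psi$-Lipschitz continuous gradient. Then, for $\epsilon>0$ and for all $x,x'\in\mathbb{R}^n$, $$\Delta_H\bigl(\partial_\epsilon\psi(x),\partial_\epsilon\psi(x')\bigr)\le L_\psi\|x-x'\| .$$
   Context: The $\epsilon$-subdifferential of a convex function $\psi$ at $x$ is $\partial_\epsilon\psi(x)=\{s\in\mathbb{R}^n : \psi(x)+\langle s,y-x\rangle-\epsilon\le\psi(y)\ \text{ for all }y\in\mathbb{R}^n\}$. $\Delta_H$ is the Hausdorff distance between nonempty compact convex sets, $\Delta_H(A,B)=\max\{|\sigma_A(d)-\sigma_B(d)| : \|d\|=1\}$, where $\sigma_A(d)=\sup\{\langle a,d\rangle : a\in A\}$ is the support function of $A$. *)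

(* Defs.v *)
From HB Require Import structures.
From mathcomp Require Import all_boot all_order all_algebra.
From mathcomp Require Import all_classical all_reals all_analysis.

Set Implicit Arguments.
Unset Strict Implicit.
Unset Printing Implicit Defensive.

Import Order.TTheory GRing.Theory Num.Theory.
Import numFieldNormedType.Exports.

Local Open Scope classical_set_scope.
Local Open Scope ring_scope.

Section Euclidean.
Context {R : realType} {n : nat}.
Implicit Types (u v x d s : 'rV[R]_n) (A B : set 'rV[R]_n) (psi : 'rV[R]_n -> R).

Definition dotv u v : R := \sum_(i < n) u ord0 i * v ord0 i.

(* The library norm `|u| on 'rV[R]_n is the max norm.  It induces the same
   topology (hence the same continuity and differentiability), but Lipschitz
   constants and the unit sphere depend on the norm, so they use this one. *)
Definition enorm u : R := Num.sqrt (dotv u u).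

Definition gradient psi x : 'rV[R]_n :=
  \row_(i < n) 'D_(delta_mx ord0 i : 'rV[R]_n) psi x.

Definition continuously_differentiable psi :=
  (forall x, differentiable psi x) /\ continuous (gradient psi).

Definition elipschitz (L : R) (F : 'rV[R]_n -> 'rV[R]_n) :=
  forall x y, enorm (F x - F y) <= L * enorm (x - y).

Definition proper_function (f : 'rV[R]_n -> \bar R) :=
  (exists x, (f x < +oo)%E) /\ (forall x, (-oo < f x)%E).

Definition eps_subdifferential (eps : R) psi x : set 'rV[R]_n :=
  [set s | forall y, psi x + dotv s (y - x) - eps <= psi y].

(* The suprema are taken in \bar R, so that no default value is involved on
   empty or unbounded sets.  If a support function takes an infinite value at
   d, then `|support_function A d - support_function B d| = +oo, including in
   the cases oo - oo, since +oo - +oo = -oo - -oo = -oo in \bar R. *)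
Definition support_function A d : \bar R :=
  ereal_sup [set (dotv a d)%:E | a in A].

Definition hausdorff_distance A B : \bar R :=
  ereal_sup [set `|support_function A d - support_function B d|%E
            | d in [set d | enorm d = 1]].

End Euclidean.

(* Main.v *)
Require Import Defs.
From HB Require Import structures.
From mathcomp Require Import all_boot all_order all_algebra.
From mathcomp Require Import all_classical all_reals all_analysis.
From mathcomp Require Import ring lra.
Set Implicit Arguments.
Unset Strict Implicit.
Unset Printing Implicit Defensive.
Import Order.TTheory GRing.Theory Num.Theory.
Import numFieldNormedType.Exports.
Local Open Scope classical_set_scope.
Local Open Scope ring_scope.

(** The support function of the eps-subdifferential of psi at x in the direction
    d is the eps-directional derivative
      inf over t > 0 of (psi (x + t d) - psi x + eps) / t.
    For a unit vector d the quantities under these infima at x and at x' differ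
    by at most L |x - x'|, for every t separately: the increments of psi along
    the two parallel segments from x to x + t d and from x' to x' + t d differ
    by the integral of <grad psi (x + s d) - grad psi (x' + s d), d> over
    0 <= s <= t, and the integrand is at most L |x - x'| by Cauchy-Schwarz and
    the Lipschitz hypothesis ([line_increment_le], with the mean value theorem
    in the place of the integral).  Hence so do the infima.

    That every element s of the eps-subdifferential satisfies
    <s, d> <= (psi (x + t d) - psi x + eps) / t is the defining inequality at
    y = x + t d ([eps_slope_le]).  For the converse one needs elements of the
    eps-subdifferential that almost attain the infimum.  Differentiability
    provides them without any separation argument: grad psi z belongs to the
    eps-subdifferential at x as soon as the tangent hyperplane at z lies at
    most eps below psi at x, and a suitable z = x + t d on the ray does it
    ([eps_slope_almost_attained]).  At a minimiser t of the quotient the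
    derivative vanishes, which says both that <grad psi z, d> is the value of
    the quotient and that the gap of the tangent hyperplane is exactly eps;
    when the infimum is only approached as t tends to infinity, a large t
    serves up to an arbitrarily small error. *)

Section InnerProduct.
Context {R : realType} {n : nat}.
Implicit Types (u v w d : 'rV[R]_n) (a : R).

Lemma dotvC u v : dotv u v = dotv v u.
Proof. by apply: eq_bigr => i _; rewrite mulrC. Qed.

Lemma dotvDl u v w : dotv (u + v) w = dotv u w + dotv v w.
Proof. by rewrite -big_split; apply: eq_bigr => i _; rewrite mxE mulrDl. Qed.

Lemma dotvZl a u v : dotv (a *: u) v = a * dotv u v.
Proof. by rewrite /dotv mulr_sumr; apply: eq_bigr => i _; rewrite mxE mulrA. Qed.

Lemma dotvBl u v w : dotv (u - v) w = dotv u w - dotv v w.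
Proof. by rewrite dotvDl -scaleN1r dotvZl mulN1r. Qed.

Lemma dotvZr a u v : dotv u (a *: v) = a * dotv u v.
Proof. by rewrite dotvC dotvZl dotvC. Qed.

Lemma dotvBr u v w : dotv u (v - w) = dotv u v - dotv u w.
Proof. by rewrite dotvC dotvBl !(dotvC u). Qed.

Lemma dotvv_ge0 u : 0 <= dotv u u.
Proof. by apply: sumr_ge0 => i _; rewrite -expr2 sqr_ge0. Qed.

Lemma enorm_sqr u : enorm u ^+ 2 = dotv u u.
Proof. by rewrite sqr_sqrtr ?dotvv_ge0. Qed.

(** Cauchy-Schwarz for a unit vector d: the residue of u after its projection
    on d has a nonnegative square norm. *)
Lemma dotv_le_enorm u d : enorm d = 1 -> dotv u d <= enorm u.
Proof.
move=> d1; have dd : dotv d d = 1 by rewrite -enorm_sqr d1 expr1n.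
have := dotvv_ge0 (u - dotv u d *: d).
rewrite !(dotvBl, dotvBr, dotvZl, dotvZr) dd (dotvC d) => h.
apply: le_trans (ler_norm _) _.
rewrite -sqrtr_sqr; apply: ler_wsqrtr; nra.
Qed.

Lemma enormBC u v : enorm (u - v) = enorm (v - u).
Proof. by rewrite /enorm -opprB -scaleN1r dotvZl dotvZr !mulN1r opprK. Qed.

End InnerProduct.

Section Line.
Context {R : realType} {n : nat}.
Implicit Types (psi : 'rV[R]_n -> R) (x y z d v : 'rV[R]_n) (t : R).

Lemma derive_gradient psi x v :
  differentiable psi x -> 'D_v psi x = dotv (gradient psi x) v.
Proof.
move=> dpsi; rewrite deriveE// {1}[v]row_sum_delta linear_sum.
apply: eq_bigr => i _.
by rewrite linearZ /= mxE deriveE// mulrC.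
Qed.

(** Reduces calculus along a ray to functions of one real variable, to which the
    mean value and intermediate value theorems apply. *)
Lemma is_derive_line psi x d t : differentiable psi (x + t *: d) ->
  is_derive t (1 : R) (fun s => psi (x + s *: d))
    (dotv (gradient psi (x + t *: d)) d).
Proof.
move=> dpsi.
(* Both derivatives are limits of the same difference quotient. *)
have E : (fun h : R => h^-1 *: (psi (x + (h *: 1 + t) *: d) - psi (x + t *: d)))
  = (fun h => h^-1 *: ((psi \o shift (x + t *: d)) (h *: d) - psi (x + t *: d))).
  apply/funext => h /=; do 3 congr (_ _).
  by rewrite scalerDl /GRing.scale/= mulr1 addrCA.
have := @diff_derivable _ _ _ _ _ d dpsi.
rewrite -derive_gradient// /derivable -E => cv.
split; first exact: cv.
by rewrite /derive -E.
Qed.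

Lemma gradient_line_continuous psi x d : continuous (gradient psi) ->
  continuous (fun t : R => dotv (gradient psi (x + t *: d)) d).
Proof.
move=> cg t.
apply: (@cvg_big _ _ _ _ _ add_continuous) => i _.
apply: cvgM; last exact: cvg_cst.
have cl : (x + s *: d) @[s --> t] --> x + t *: d.
  by apply: cvgD; [exact: cvg_cst|apply: cvgZr_tmp; exact: cvg_id].
have /(cvg_comp _ _ cl) cgl := cg (x + t *: d).
exact: cvg_comp cgl (@coord_continuous _ _ _ _ _ _).
Qed.

(** By convexity the difference quotients towards y with step 0 < h <= 1 are at
    most psi y - psi x, and the directional derivative is their limit. *)
Lemma convex_gradient_le psi x y :
  convex_function [set: convex_lmodType 'rV[R]_n] psi ->
  differentiable psi x ->
  psi x + dotv (gradient psi x) (y - x) <= psi y.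
Proof.
move=> cpsi dpsi.
rewrite -lerBrDl -derive_gradient//.
have cv : (h^-1 *: ((psi \o shift x) (h *: (y - x)) - psi x)) @[h --> 0^'+]
   --> 'D_(y - x) psi x.
  exact/cvg_dnbhs_at_right/diff_derivable.
apply: (cvgr_to_le cv); near=> h.
have h0 : 0 < h by near: h; exact: nbhs_right_gt.
have h1 : h <= 1 by near: h; exact: nbhs_right_le.
have hc : psi (h *: y + (1 - h) *: x) <= h * psi y + (1 - h) * psi x.
  exact: (cpsi (Itv01 (ltW h0) h1) y x (mem_set I) (mem_set I)).
move: hc; have -> : h *: y + (1 - h) *: x = h *: (y - x) + x.
  by rewrite scalerBr scalerBl scale1r addrA addrAC.
by rewrite /GRing.scale/= ler_pdivrMl// => hc; lra.
Unshelve. all: end_near. Qed.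

(** The mean value theorem is applied to the difference of psi along two
    parallel segments: the two arguments of the gradient then always differ by
    x - x', so that the bound does not degrade with s, and it is linear in t,
    as needed for dividing by t afterwards. *)
Lemma line_increment_le psi L x x' d t :
  (forall z, differentiable psi z) -> elipschitz L (gradient psi) ->
  enorm d = 1 -> 0 <= t ->
  psi (x + t *: d) - psi x <=
    psi (x' + t *: d) - psi x' + L * enorm (x - x') * t.
Proof.
move=> dpsi lip d1 t0.
pose g (s : R) : R := psi (x + s *: d) - psi (x' + s *: d).
have dg (s : R) : is_derive s (1 : R) g (dotv (gradient psi (x + s *: d)) d
                             - dotv (gradient psi (x' + s *: d)) d).
  by apply: is_deriveB; exact: is_derive_line.
have [|s _] := MVT_segment t0 (fun s _ => dg s).
  by apply: derivable_within_continuous => s _; apply: ex_derive.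
rewrite /g !scale0r !addr0 subr0 -dotvBl => E.
have : dotv (gradient psi (x + s *: d) - gradient psi (x' + s *: d)) d
       <= L * enorm (x - x').
  apply: le_trans (dotv_le_enorm _ d1) _.
  by apply: le_trans (lip _ _) _; rewrite opprD addrACA subrr addr0.
move=> /(ler_wpM2r t0); lra.
Qed.

(** The left-hand side of the last hypothesis is the gap at x between psi and
    its tangent hyperplane at z.  This hyperplane minorises psi, and lowering
    by eps the parallel hyperplane through the graph at x puts it below the
    tangent one. *)
Lemma gradient_in_eps_subdifferential eps psi x z :
  convex_function [set: convex_lmodType 'rV[R]_n] psi ->
  differentiable psi z ->
  psi x - psi z - dotv (gradient psi z) (x - z) <= eps ->
  eps_subdifferential eps psi x (gradient psi z).
Proof.
move=> cpsi dpsi hz y.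
have := convex_gradient_le y cpsi dpsi.
move: hz; rewrite !dotvBr; lra.
Qed.

Lemma eps_slope_le eps psi x d t s : 0 < t ->
  eps_subdifferential eps psi x s ->
  dotv s d <= (psi (x + t *: d) - psi x + eps) / t.
Proof.
move=> t0 /(_ (x + t *: d)).
rewrite [x + _ - x]addrAC subrr add0r dotvZr ler_pdivlMr// mulrC; lra.
Qed.

(** The gap e t at x of the tangent hyperplane at x + t d is continuous in t and
    vanishes at 0.  Where it equals eps, <grad psi (x + t d), d> equals the
    eps-slope.  Where it is at most eps, the gradient is still an
    eps-subgradient at x, and convexity bounds <grad psi (x + t d), d> below by
    the slope without eps, whose distance eps / t to the eps-slope is small for
    large t. *)
Lemma eps_slope_almost_attained eps delta psi x d :
  convex_function [set: convex_lmodType 'rV[R]_n] psi ->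
  continuously_differentiable psi ->
  0 < eps -> 0 < delta ->
  exists t, [/\ 0 < t,
    eps_subdifferential eps psi x (gradient psi (x + t *: d)) &
    (psi (x + t *: d) - psi x + eps) / t
      <= dotv (gradient psi (x + t *: d)) d + delta].
Proof.
move=> cpsi [dpsi cg] eps0 delta0.
pose e t := psi x - psi (x + t *: d) + t * dotv (gradient psi (x + t *: d)) d.
have in_subdiff t : e t <= eps ->
    eps_subdifferential eps psi x (gradient psi (x + t *: d)).
  move=> et; apply: gradient_in_eps_subdifferential => //.
  by rewrite opprD addNKr -scaleNr dotvZr mulNr opprK.
have e0 : e 0 = 0 by rewrite /e scale0r addr0 mul0r subrr addr0.
(* At t0 the error eps / t is exactly delta: either t0 itself serves, or e
   takes the value eps before t0. *)
pose t0 := eps / delta.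
have t0_gt0 : 0 < t0 by exact: divr_gt0.
have [le_e|lt_e] := leP (e t0) eps.
  exists t0; split; [by []|exact: in_subdiff|].
  have := convex_gradient_le x cpsi (dpsi (x + t0 *: d)).
  rewrite opprD addNKr -scaleNr dotvZr ler_pdivrMr// mulrDl.
  by rewrite [delta * _]mulrC /t0 divfK ?gt_eqF//; lra.
have ce : continuous e.
  move=> t; apply: cvgD; last first.
    by apply: cvgM; [exact: cvg_id|exact: gradient_line_continuous].
  apply: cvgB; first exact: cvg_cst.
  apply: differentiable_continuous; apply/derivable1_diffP.
  by have [] := is_derive_line (dpsi (x + t *: d)).
have [||t] := @IVT _ e 0 t0 eps (ltW t0_gt0).
- exact: continuous_subspaceT.
- by rewrite e0 min_l ?max_r; lra.
rewrite in_itv/= => /andP[t_ge0 _] et.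
have t_gt0 : 0 < t.
  by rewrite lt_neqAle t_ge0 andbT; apply: contraPneq et => <-; rewrite e0; lra.
exists t; split; [by []|by apply: in_subdiff; rewrite et|].
rewrite ler_pdivrMr//; move: et; rewrite /e.
have := mulr_gt0 delta0 t_gt0; lra.
Qed.

End Line.

Section SupportFunction.
Context {R : realType} {n : nat}.
Implicit Types (psi : 'rV[R]_n -> R) (x d : 'rV[R]_n) (eps : R).

(** Finiteness makes the difference of the two support functions meaningful:
    the gradient at x witnesses that the set is nonempty, and the eps-slope
    with t = 1 bounds it in the direction d. *)
Lemma support_function_fin_num eps psi x d : 0 <= eps ->
  convex_function [set: convex_lmodType 'rV[R]_n] psi ->
  differentiable psi x ->
  support_function (eps_subdifferential eps psi x) d \is a fin_num.
Proof.
move=> eps0 cpsi dpsi; apply: fin_real; apply/andP; split.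
  apply: lt_le_trans (ltNyr (dotv (gradient psi x) d)) _.
  apply: ereal_sup_ubound; exists (gradient psi x) => //.
  apply: gradient_in_eps_subdifferential => //.
  by rewrite dotvBr; lra.
apply: le_lt_trans (ltry ((psi (x + 1 *: d) - psi x + eps) / 1)).
apply: ge_ereal_sup => _ [s ss <-].
by rewrite lee_fin; exact: eps_slope_le.
Qed.

(** One half of the estimate; the other one is obtained by exchanging x and x'.
    The same t is used at both points: it is chosen so that the eps-slope at x'
    is almost attained, and the eps-slope at x for that t is an upper bound. *)
Lemma support_function_le eps psi L x x' d :
  convex_function [set: convex_lmodType 'rV[R]_n] psi ->
  continuously_differentiable psi -> elipschitz L (gradient psi) ->
  0 < eps -> enorm d = 1 ->
  (support_function (eps_subdifferential eps psi x) d <=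
   support_function (eps_subdifferential eps psi x') d
     + (L * enorm (x - x'))%:E)%E.
Proof.
move=> cpsi psi_C1 lip eps0 d1; apply/lee_addgt0Pr => delta delta0.
have [t [t0 in' le']] := eps_slope_almost_attained x' d cpsi psi_C1 eps0 delta0.
apply: ge_ereal_sup => _ [s ss <-].
have le_sup : ((dotv (gradient psi (x' + t *: d)) d)%:E
    <= support_function (eps_subdifferential eps psi x') d)%E.
  by apply: ereal_sup_ubound; exists (gradient psi (x' + t *: d)).
rewrite -addeA; apply: le_trans (leeD2r _ le_sup).
rewrite lee_fin.
have h := eps_slope_le d t0 ss.
have := line_increment_le x x' psi_C1.1 lip d1 (ltW t0) => hl.
have : (psi (x + t *: d) - psi x + eps) / t
   <= (psi (x' + t *: d) - psi x' + eps) / t + L * enorm (x - x').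
  rewrite ler_pdivrMr// mulrDl divfK ?gt_eqF//; lra.
lra.
Qed.

End SupportFunction.

Theorem proposition18 (R : realType) (n : nat) (psi : 'rV[R]_n -> R) (L : R)
    (psi_proper : proper_function (EFin \o psi))
    (psi_lsc : lower_semicontinuous (EFin \o psi))
    (psi_convex : convex_function [set: convex_lmodType 'rV[R]_n] psi)
    (psi_C1 : continuously_differentiable psi)
    (psi_lip : elipschitz L (gradient psi))
    (eps : R) (eps_gt0 : 0 < eps) (x x' : 'rV[R]_n) :
  (hausdorff_distance (eps_subdifferential eps psi x)
                      (eps_subdifferential eps psi x')
     <= (L * enorm (x - x'))%:E)%E.
Proof.
apply: ge_ereal_sup => _ [d d1 <-].
have le1 := support_function_le x x' psi_convex psi_C1 psi_lip eps_gt0 d1.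
have le2 := support_function_le x' x psi_convex psi_C1 psi_lip eps_gt0 d1.
have fin z := support_function_fin_num d (ltW eps_gt0) psi_convex (psi_C1.1 z).
move: le1 le2; rewrite -(fineK (fin x)) -(fineK (fin x')) !lee_fin.
by rewrite (enormBC x') ler_norml => le1 le2; apply/andP; split; lra.
Qed.
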